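(* Let $\ell\ge1$, $k\ge1$ be integers and $\zeta>0$. The $k$ zeros $\{x_{i,k}^{(\ell)}\}_{i=1}^{k}$ of $P_{k}^{(\ell)}(\cdot;\zeta)$ and the $k+1$ zeros $\{x_{i,k+1}^{(\ell-1)}\}_{i=1}^{k+1}$ of $P_{k+1}^{(\ell-1)}(\cdot;\zeta)$ satisfy $$1<x_{1,k+1}^{(\ell-1)}<x_{1,k}^{(\ell)}<x_{2,k+1}^{(\ell-1)}<\cdots<x_{k,k}^{(\ell)}<x_{k+1,k+1}^{(\ell-1)}.$$
   Context: For $\zeta>0$ and an integer $\ell\ge0$, $\omega^{(\ell)}(x;\zeta)=\frac{\zeta(x^2-1)^{\ell+1/2}}{(2\ell+1)K_{2}(\zeta)}e^{-\zeta x}$ on $[1,+\infty)$, where $K_\nu$ is the modified Bessel function of the second kind. $\{P_k^{(\ell)}(x;\zeta)\}_{k\ge0}$ are the polynomials with $\deg P_k^{(\ell)}=k$ and positive leading coefficient that are orthonormal with respect to $(f,g)_{\omega^{(\ell)}}=\int_1^\infty fg\,\omega^{(\ell)}(x;\zeta)\,dx$. The zeros of $P_k^{(\ell)}(\cdot;\zeta)$ are real, simple and lie in $(1,+\infty)$; they are denoted in increasing order by $x_{1,k}^{(\ell)}<\dots<x_{k,k}^{(\ell)}$. *)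

(* Defs.v *)
From mathcomp Require Import all_boot all_order all_algebra.
From mathcomp Require Import polyrcf.
From mathcomp Require Import all_classical all_reals all_analysis.

Set Implicit Arguments.
Unset Strict Implicit.
Unset Printing Implicit Defensive.

Import Order.TTheory GRing.Theory Num.Theory.

Local Open Scope classical_set_scope.
Local Open Scope ring_scope.

Section Definitions.
Variable R : realType.
Implicit Types (nu zeta x t : R) (l k i : nat) (p f g : {poly R}).

Definition cosh t : R := (expR t + expR (- t)) / 2.

(* K_nu(zeta), by its integral representation, valid for zeta > 0. *)
Definition besselK nu zeta : R :=
  \int[lebesgue_measure]_(t in `[0, +oo[) (cosh (nu * t) * expR (- zeta * cosh t)).

(* Only used for 1 <= x. *)
Definition omega l zeta x : R :=
  zeta * (x ^+ 2 - 1) `^ (l%:R + 1 / 2)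
    / ((2 * l%:R + 1) * besselK 2 zeta) * expR (- zeta * x).

(* The integrand is always Lebesgue integrable when 0 < zeta, so the default
   value of the real-valued integral plays no role. *)
Definition omega_inner l zeta f g : R :=
  \int[lebesgue_measure]_(x in `[1, +oo[) (f.[x] * g.[x] * omega l zeta x).

Definition orthonormal_polys l zeta (P : nat -> {poly R}) : Prop :=
  [/\ forall k, size (P k) = k.+1,
      forall k, 0 < lead_coef (P k)
    & forall j k, omega_inner l zeta (P j) (P k) = (j == k)%:R].

(* The i-th smallest distinct real zero of p, counted from i = 1; the value is
   0 when i exceeds the number of such zeros. *)
Definition poly_zero p i : R := (rootsR p)`_i.-1.

End Definitions.

(* Main.v *)
Require Import Defs.
From HB Require Import structures.
From mathcomp Require Import all_boot all_order all_algebra.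
From mathcomp Require Import polyrcf.
From mathcomp Require Import ring lra zify.
From mathcomp Require Import all_classical all_reals all_analysis.
From mathcomp Require Import measurable_realfun pi_irrational.

(** Up to a constant factor the weights satisfy
    [omega l.+1 = (x^2 - 1) * omega l] on [1, +oo[, so [q = P l k] is
    orthogonal to lower degrees for the functional [f |-> L ((x^2 - 1) f)],
    where [L] is integration against the weight for which [p = P l.-1 k.+1] is
    orthogonal to lower degrees.  Only the positivity of [L] matters.

    Take two roots [b], [c] of [p], which are simple, and write
    [p = (x - b) (x - c) r].  Gauss quadrature, exact in degree [2 k + 1],
    applied to [(x^2 - 1) q r] has only the nodes [b] and [c] left, since [r]
    kills the others, and the integral itself vanishes because
    [size r < size q].  Hence a combination of [q(b) / r(b)] and [q(c) / r(c)]
    with positive coefficients is zero: this is [two_node_relation], deduced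
    from the quadrature formula [two_node_quadrature].

    - If [q] vanished at one root of [p] it would vanish at all [k + 1] of them,
      which exceeds its degree [k] ([christoffel_neq0]).
    - If [b] and [c] are consecutive, [r] has the same sign at both, so [q]
      changes sign between them ([christoffel_changes_sign]).

    Thus [q] has a root in each of the [k] gaps between consecutive roots of
    [p], and these are all its roots ([rootsR_interlace]).  That [p] has [k + 1]
    roots, simple and larger than [1], is the usual argument
    ([size_nonneg_factor]): if [p = g t] with [g >= 0] nonconstant, then
    [L (p t) = L (g t^2) > 0] contradicts orthogonality.

    The analytic input is that [L] is finite, linear and strictly positive. *)

Set Implicit Arguments.
Unset Strict Implicit.
Unset Printing Implicit Defensive.

Import Order.TTheory GRing.Theory Num.Theory.
Local Open Scope ring_scope.

(** * Orthogonal polynomials for a positive functional *)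

Section PositiveFunctionals.
Variables (R : rcfType) (a : R) (L : {scalar {poly R}}).
Implicit Types (p q f g h r s t : {poly R}) (b c x y z : R).

Definition positive_functional :=
  forall f, f != 0 -> (forall x, a <= x -> 0 <= f.[x]) -> 0 < L f.

Definition orthogonal_to_lower p :=
  forall s, (size s < size p)%N -> L (p * s) = 0.

(* size_mul for the ring structure that R has as a real closed field, so that
   the sizes it produces are literally those of the other hypotheses. *)
Let sizeM f g : f != 0 -> g != 0 -> size (f * g) = (size f + size g).-1.
Proof. exact: size_mul. Qed.

Lemma noroot_same_sign g b c :
  (forall x, b <= x <= c -> ~~ root g x) -> b <= c -> 0 < g.[b] * g.[c].
Proof.
move=> nr bc; rewrite ltNge; apply/negP => gbc.
have [x /nr xNr rx] := polyrcf.poly_ivt bc gbc.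
by rewrite rx in xNr.
Qed.

Hypothesis Lpos : positive_functional.

(** The cofactor [t] of a nonconstant [g] would be of lower degree than [p],
    whereas [p * t = g * t ^+ 2] is nonnegative.  Applied with [g] linear, [g]
    the square of a linear factor, or [g] without real root, this yields the
    location, the simplicity and the number of the roots of [p]. *)
Lemma size_nonneg_factor p g t :
  orthogonal_to_lower p -> p != 0 -> p = g * t ->
  (forall x, a <= x -> 0 <= g.[x]) -> (size g <= 1)%N.
Proof.
move=> Op p0 pE g0; rewrite leqNgt; apply/negP => sg.
have g_n0 : g != 0 by apply: contraNneq p0 => g0'; rewrite pE g0' mul0r.
have t_n0 : t != 0 by apply: contraNneq p0 => t0'; rewrite pE t0' mulr0.
have : 0 < L (p * t).
  apply: Lpos => [|x ax]; first by rewrite mulf_neq0.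
  by rewrite pE !hornerE -mulrA mulr_ge0 ?g0 // -expr2 sqr_ge0.
rewrite Op ?ltxx // pE sizeM //.
have st : (0 < size t)%N by rewrite size_poly_gt0.
lia.
Qed.

Section Orthogonal.
Variable p : {poly R}.
Hypotheses (Op : orthogonal_to_lower p) (p_n0 : p != 0).

Lemma orthogonal_roots_gt c : root p c -> a < c.
Proof.
move=> /factor_theorem[t pE]; rewrite ltNge; apply/negP => ca.
have : (size ('X - c%:P)%R <= 1)%N.
  apply: (@size_nonneg_factor p _ t) => // [|x ax]; first by rewrite mulrC.
  by rewrite !hornerE subr_ge0 (le_trans ca).
by rewrite size_XsubC.
Qed.

Lemma orthogonal_roots_simple c r : p = ('X - c%:P) * ('X - c%:P) * r -> False.
Proof.
move=> pE.
have : (size (('X - c%:P) * ('X - c%:P))%R <= 1)%N.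
  apply: (@size_nonneg_factor p _ r) => // x ax.
  by rewrite !hornerE -expr2 sqr_ge0.
by rewrite sizeM ?polyXsubC_eq0 // !size_XsubC.
Qed.

Lemma mem_rootsR c : (c \in rootsR p) = root p c.
Proof. by rewrite -roots_on_rootsR // in_itv. Qed.

Lemma size_orthogonal_rootsR : size (rootsR p) = (size p).-1.
Proof.
set t := \prod_(z <- rootsR p) ('X - z%:P).
have [g pE] : exists g, p = g * t.
  apply: uniq_roots_prod_XsubC.
    by apply/allP => z; rewrite mem_rootsR.
  by rewrite uniq_rootsE uniq_roots.
have g_n0 : g != 0 by apply: contraNneq p_n0 => g0; rewrite pE g0 mul0r.
(* every root of p already divides t, so a root of g would be a double one *)
have noroot_g c : ~~ root g c.
  apply/negP => gc.
  have : root t c.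
    by rewrite root_prod_XsubC mem_rootsR pE rootM gc.
  move=> /factor_theorem[t' tE]; move: gc => /factor_theorem[g' gE].
  by apply: (@orthogonal_roots_simple c (g' * t')); rewrite pE tE gE; ring.
(* g has constant sign, hence either g or - g is a nonnegative factor of p *)
have sg : (size g <= 1)%N.
  have ga x : a <= x -> 0 < g.[a] * g.[x].
    by move=> ax; apply: noroot_same_sign => // y _.
  have [g0|g0] := ltP 0 g.[a].
    apply: (size_nonneg_factor Op p_n0 pE) => x /ga.
    by rewrite pmulr_rgt0 // => /ltW.
  rewrite -size_polyN; apply: (@size_nonneg_factor p _ (- t)) => //.
    by rewrite mulrNN.
  by move=> x /ga; rewrite !hornerE; nra.
have /size_poly1P[c c0 gC] : size g == 1%N.
  by rewrite eqn_leq sg size_poly_gt0.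
by rewrite [in RHS]pE gC mul_polyC size_scale // size_prod_XsubC.
Qed.

(** Gauss quadrature for a polynomial [f * r] that vanishes at all the nodes but
    [b] and [c].  The values [L ((p / (x - b)) ^+ 2)] stand for the Christoffel
    numbers, up to normalization, which makes their positivity evident. *)
Lemma two_node_quadrature b c r f : b != c ->
  p = ('X - b%:P) * ('X - c%:P) * r -> r.[b] != 0 -> r.[c] != 0 ->
  (size f <= (size p).+1)%N ->
  (b - c) ^+ 2 * L (f * r) =
    f.[b] / r.[b] * L ((('X - c%:P) * r) ^+ 2)
    + f.[c] / r.[c] * L ((('X - b%:P) * r) ^+ 2).
Proof.
move=> bc pE rb rc sf.
have bc0 : b - c != 0 by rewrite subr_eq0.
set u := f.[b] / r.[b]; set v := f.[c] / r.[c].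
(* the difference of the two sides is L (e * r), and e vanishes at b and c, so
   that e * r is a multiple of p by a polynomial of lower degree *)
pose e := (b - c) ^+ 2 *: f - u *: (('X - c%:P) ^+ 2 * r)
          - v *: (('X - b%:P) ^+ 2 * r).
have [s es] : exists s, e = s * \prod_(z <- [:: b; c]) ('X - z%:P).
  apply: uniq_roots_prod_XsubC; last by rewrite uniq_rootsE /= inE bc.
  by rewrite /= andbT /root /e /u /v !hornerE /=; apply/andP; split;
    apply/eqP; field; rewrite rb rc.
rewrite big_cons big_seq1 in es.
have r_n0 : r != 0 by apply: contraNneq rb => ->; rewrite hornerE.
have sp : size p = (size r).+2.
  rewrite pE !sizeM ?mulf_neq0 ?polyXsubC_eq0 // !size_XsubC; lia.
have spXr z : (size (('X - z%:P) ^+ 2 * r)%R <= size p)%N.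
  rewrite sp expr2 !sizeM ?mulf_neq0 ?polyXsubC_eq0 // !size_XsubC; lia.
have se : (size e <= (size p).+1)%N.
  rewrite (leq_trans (size_polyD _ _)) // geq_max size_polyN.
  rewrite (leq_trans (size_scale_leq _ _)) ?(leq_trans (spXr b)) // andbT.
  rewrite (leq_trans (size_polyD _ _)) // geq_max size_polyN.
  rewrite (leq_trans (size_scale_leq _ _) sf) /=.
  by rewrite (leq_trans (size_scale_leq _ _)) ?(leq_trans (spXr c)).
have : L (p * s) = 0.
  apply: Op; have [->|s0] := eqVneq s 0; first by rewrite size_poly0 sp.
  move: se; rewrite es !sizeM ?mulf_neq0 ?polyXsubC_eq0 // !size_XsubC; lia.
have -> : p * s = (b - c) ^+ 2 *: (f * r) - u *: (('X - c%:P) * r) ^+ 2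
     - v *: (('X - b%:P) * r) ^+ 2.
  transitivity (e * r); first by rewrite es pE; ring.
  by rewrite /e -!mul_polyC; ring.
rewrite !linearB !linearZ /=; lra.
Qed.

(** From here on [q] is the orthogonal polynomial, of degree one less than [p],
    for the Christoffel transform [f |-> L (h * f)] of [L].  The bound on the
    degree of [h] keeps [h * q * r] within the range where the quadrature at the
    roots of [p] is exact. *)
Variables q h : {poly R}.
Hypothesis (q_n0 : q != 0).
Hypothesis size_q : size p = (size q).+1.
Hypothesis size_h : (size h <= 3)%N.
Hypothesis h_gt0 : forall x, a < x -> 0 < h.[x].
Hypothesis Oq : forall s, (size s < size q)%N -> L (h * (q * s)) = 0.

(** For [f = h * q] the left-hand side of the quadrature formula is zero, as
    [r] is of lower degree than [q]; and [h] is positive at the nodes, which lie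
    beyond [a]. *)
Lemma two_node_relation b c r : b != c ->
  p = ('X - b%:P) * ('X - c%:P) * r ->
  [/\ r.[b] != 0, r.[c] != 0 &
  exists u v, [/\ 0 < u, 0 < v & q.[b] / r.[b] * u + q.[c] / r.[c] * v = 0]].
Proof.
move=> bc pE.
have rb : r.[b] != 0.
  apply/negP => /factor_theorem[r' rE].
  by apply: (@orthogonal_roots_simple b (('X - c%:P) * r')); rewrite pE rE; ring.
have rc : r.[c] != 0.
  apply/negP => /factor_theorem[r' rE].
  by apply: (@orthogonal_roots_simple c (('X - b%:P) * r')); rewrite pE rE; ring.
split=> //.
have r_n0 : r != 0 by apply: contraNneq rb => ->; rewrite hornerE.
have sp : size p = (size r).+2.
  rewrite pE !sizeM ?mulf_neq0 ?polyXsubC_eq0 // !size_XsubC; lia.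
have shq : (size (h * q)%R <= (size p).+1)%N.
  rewrite (leq_trans (size_polyMleq _ _)) //; lia.
have := two_node_quadrature bc pE rb rc shq.
rewrite -mulrA Oq ?mulr0; last by lia.
rewrite !hornerM => E.
have pb : root p b by rewrite pE !rootM root_XsubC eqxx.
have pc : root p c by rewrite pE !rootM !root_XsubC eqxx orbT.
have sq_pos z : 0 < L ((('X - z%:P) * r) ^+ 2).
  apply: Lpos => [|x _]; first by rewrite expf_neq0 ?mulf_neq0 ?polyXsubC_eq0.
  by rewrite horner_exp sqr_ge0.
exists (h.[b] * L ((('X - c%:P) * r) ^+ 2)),
  (h.[c] * L ((('X - b%:P) * r) ^+ 2)).
rewrite !mulr_gt0 ?h_gt0 ?orthogonal_roots_gt //; split=> //.
rewrite [RHS]E; ring.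
Qed.

Lemma two_roots_factor b c : b != c -> root p b -> root p c ->
  exists r, p = ('X - b%:P) * ('X - c%:P) * r.
Proof.
move=> bc pb pc.
have [r ->] : exists r, p = r * \prod_(z <- [:: b; c]) ('X - z%:P).
  apply: uniq_roots_prod_XsubC; last by rewrite uniq_rootsE /= inE bc.
  by rewrite /= pb pc.
by exists r; rewrite big_cons big_seq1 mulrC.
Qed.

(** The relation between two nodes propagates a zero of [q] from one root of [p]
    to all the others, which are too many for the degree of [q]. *)
Lemma christoffel_neq0 b : root p b -> q.[b] != 0.
Proof.
move=> pb; apply/eqP => qb.
have : (size (rootsR p) < size q)%N.
  apply: max_poly_roots => //; last by rewrite uniq_roots.
  apply/allP => c; rewrite mem_rootsR => pc.
  have [<-|bc] := eqVneq b c; first exact/eqP.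
  have [r pE] := two_roots_factor bc pb pc.
  have [rb rc [u [v [u0 v0]]]] := two_node_relation bc pE.
  rewrite qb !mul0r add0r => /eqP.
  by rewrite !mulf_eq0 invr_eq0 (negPf rc) (gt_eqF v0) !orbF.
by rewrite size_orthogonal_rootsR size_q ltnn.
Qed.

(** The cofactor [r] has no root between the consecutive roots [b] and [c], so
    the relation between these nodes forces [q.[b]] and [q.[c]] to have opposite
    signs. *)
Lemma christoffel_changes_sign b c : b < c -> root p b -> root p c ->
  (forall x, b < x < c -> ~~ root p x) -> q.[b] * q.[c] < 0.
Proof.
move=> bc pb pc nr.
have bc' : b != c by rewrite lt_eqF.
have [r pE] := two_roots_factor bc' pb pc.
have [rb rc [u [v [u0 v0]]]] := two_node_relation bc' pE.
have : 0 < r.[b] * r.[c].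
  apply: noroot_same_sign (ltW bc) => x; rewrite !le_eqVlt.
  case/andP=> /orP[/eqP<- //|bx] /orP[/eqP-> //|xc].
  by have := nr x; rewrite bx xc pE rootM negb_or => /(_ isT)/andP[].
have qb := christoffel_neq0 pb; have qc := christoffel_neq0 pc.
move=> rr E.
have : q.[b] * r.[c] * u + q.[c] * r.[b] * v = 0.
  transitivity (r.[b] * r.[c] * (q.[b] / r.[b] * u + q.[c] / r.[c] * v)).
    by field; apply/andP.
  by rewrite E mulr0.
move=> E2.
(* multiply E2 by q.[c] * r.[b] to isolate the product of the two values *)
have : q.[b] * q.[c] * (r.[b] * r.[c] * u) = - (q.[c] * r.[b]) ^+ 2 * v.
  transitivity (q.[c] * r.[b] * (q.[b] * r.[c] * u)); first by ring.
  have -> : q.[b] * r.[c] * u = - (q.[c] * r.[b] * v).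
    by apply/eqP; rewrite -addr_eq0 E2.
  ring.
move=> E3.
rewrite -(pmulr_llt0 _ (mulr_gt0 rr u0)) E3 mulNr oppr_lt0 mulr_gt0 //.
by rewrite lt0r sqr_ge0 andbT expf_neq0 // mulf_neq0.
Qed.

Lemma nth_rootsR_lt i j : (i < j < (size p).-1)%N ->
  (rootsR p)`_i < (rootsR p)`_j.
Proof.
rewrite -size_orthogonal_rootsR => /andP[ij jk].
by rewrite (lt_sorted_ltn_nth _ (sorted_roots _ _ _)) ?inE // (ltn_trans ij).
Qed.

Lemma nth_rootsR_root i : (i < (size p).-1)%N -> root p (rootsR p)`_i.
Proof.
by rewrite -size_orthogonal_rootsR => ik; rewrite -mem_rootsR mem_nth.
Qed.

Lemma noroot_between_nth i x : (i.+1 < (size p).-1)%N ->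
  (rootsR p)`_i < x < (rootsR p)`_i.+1 -> ~~ root p x.
Proof.
rewrite -size_orthogonal_rootsR => ik /andP[ix xi].
rewrite -mem_rootsR; apply/negP => /(nthP 0)[j jk xj].
have ltE := lt_sorted_ltn_nth 0 (sorted_roots _ _ p).
move: ix xi; rewrite -xj !ltE ?inE // ?(ltnW ik) // => ij.
by rewrite ltnS leqNgt ij.
Qed.

(** The sign changes provide one root of [q] in each gap between consecutive
    roots of [p]; listed in order they exhaust [rootsR q] because there are as
    many of them as the degree of [q]. *)
Theorem rootsR_interlace i : (i.+1 < size q)%N ->
  (rootsR p)`_i < (rootsR q)`_i < (rootsR p)`_i.+1.
Proof.
have [k szq] : exists k, size q = k.+1.
  by exists (size q).-1; rewrite prednK // size_poly_gt0.
have szp : (size p).-1 = k.+1 by rewrite size_q szq.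
rewrite szq ltnS => ik.
have /fin_all_exists[f fP] (j : 'I_k) : exists y,
    [/\ (rootsR p)`_j < y, y < (rootsR p)`_j.+1 & root q y].
  have jp : (j.+1 < (size p).-1)%N by rewrite szp ltnS.
  have lt_j : (rootsR p)`_j < (rootsR p)`_j.+1 by rewrite nth_rootsR_lt ?ltnSn.
  have nr x := @noroot_between_nth j x jp.
  have [y /andP[? ?] ?] := poly_ivtoo (ltW lt_j) (christoffel_changes_sign lt_j
    (nth_rootsR_root (ltnW jp)) (nth_rootsR_root jp) nr).
  by exists y.
have f_incr (j1 j2 : 'I_k) : (j1 < j2)%N -> f j1 < f j2.
  move=> j12; have [_ lt1 _] := fP j1; have [lt2 _ _] := fP j2.
  apply: lt_trans lt1 (le_lt_trans _ lt2).
  move: j12; rewrite leq_eqVlt => /orP[/eqP-> //|j12].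
  by rewrite ltW // nth_rootsR_lt // j12 szp ltnW // ltnS.
pose ys := [seq f j | j <- enum 'I_k].
have ys_sorted : sorted <%R ys.
  rewrite sorted_map.
  apply: (@sub_sorted _ (relpre val ltn)) => [j1 j2|]; first exact: f_incr.
  by rewrite -sorted_map val_enum_ord iota_ltn_sorted.
have size_ys : size ys = k by rewrite size_map size_enum_ord.
have size_rq : (size (rootsR q) <= size ys)%N.
  rewrite size_ys -ltnS -szq max_poly_roots ?uniq_roots //.
  by apply/allP => y; apply: root_roots.
have ys_sub : {subset ys <= rootsR q}.
  move=> y /mapP[j _ ->]; rewrite -roots_on_rootsR // in_itv /=.
  by have [] := fP j.
have ysE : ys = rootsR q.
  apply: lt_sorted_eq => //; first exact: sorted_roots.
  by have [] := uniq_min_size (lt_sorted_uniq ys_sorted) ys_sub size_rq.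
rewrite -ysE (nth_map (Ordinal ik)) ?size_enum_ord //.
have -> : nth (Ordinal ik) (enum 'I_k) i = Ordinal ik.
  by apply: val_inj; rewrite /= nth_enum_ord.
by have [-> -> _] := fP (Ordinal ik).
Qed.
End Orthogonal.
End PositiveFunctionals.

(** Any polynomial of size at most [n] is a combination of the first [n] members
    of a family containing one polynomial of each degree. *)
Lemma orthogonal_family (R : fieldType) (L : {scalar {poly R}})
    (P : nat -> {poly R}) (k : nat) :
  (forall j, size (P j) = j.+1) ->
  (forall j, (j < k)%N -> L (P k * P j) = 0) ->
  forall s : {poly R}, (size s < size (P k))%N -> L (P k * s) = 0.
Proof.
move=> sP OP s; rewrite sP ltnS.
suff: forall n (s : {poly R}), (n <= k)%N -> (size s <= n)%N -> L (P k * s) = 0.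
  by move=> /(_ k s (leqnn k)).
elim=> [|n IH] {}s nk sn.
  by move: sn; rewrite leqn0 size_poly_eq0 => /eqP->; rewrite mulr0 linear0.
have lP : (P n)`_n != 0.
  have -> : (P n)`_n = lead_coef (P n) by rewrite lead_coefE sP.
  by rewrite lead_coef_eq0 -size_poly_eq0 sP.
pose c := s`_n / (P n)`_n.
have -> : P k * s = P k * (s - c *: P n) + c *: (P k * P n).
  by rewrite scalerAr -mulrDr subrK.
rewrite linearD [L (c *: _)]linearZ /= OP // mulr0 addr0.
apply: IH; first exact: ltnW.
apply/leq_sizeP => j; rewrite leq_eqVlt coefB coefZ => /orP[/eqP<-|nj].
  by rewrite divfK // subrr.
by rewrite !nth_default ?sP ?mulr0 ?subrr // (leq_trans sn).
Qed.

(** * Integration against the weights *)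

Section Weight.
Variable R : realType.
Implicit Types (x c zeta : R) (f g : {poly R}) (l : nat).
Local Notation mu := (@lebesgue_measure R).
Local Notation D := (`[1, +oo[%classic : set R).

(** The weight [omega] without its constant factor, which does not affect
    orthogonality. *)
Definition weight l zeta x : R :=
  (x ^+ 2 - 1) `^ (l%:R + 1 / 2) * expR (- zeta * x).

Definition moment l zeta f : R :=
  \int[mu]_(x in D) (f.[x] * weight l zeta x).

(** By Horner induction, spending half of the exponential rate at each step on
    [x <= 2 / c * expR (c / 2 * x)]. *)
Lemma poly_le_expR f c : 0 < c ->
  exists C, forall x, 0 <= x -> `|f.[x]| <= C * expR (c * x).
Proof.
elim/poly_ind: f c => [|f a IH] c c0.
  by exists 0 => x _; rewrite hornerE normr0 mul0r.
have [C HC] := IH _ (divr_gt0 c0 (ltr0Sn R 1)).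
exists (C * (2 / c) + `|a|) => x x0.
have eE : expR (c * x) = expR (c / 2 * x) * expR (c / 2 * x).
  by rewrite -expRD; congr expR; field.
have e1 : 1 <= expR (c * x) by rewrite -expR0 ler_expR mulr_ge0 // ltW.
have xe : x <= 2 / c * expR (c / 2 * x).
  have := expR_ge1Dx (c / 2 * x).
  rewrite -(@ler_pM2l _ (2 / c)) ?divr_gt0 //; apply: le_trans.
  rewrite mulrDr mulr1 mulrA.
  have -> : 2 / c * (c / 2) = 1 by field; rewrite gt_eqF.
  by rewrite mul1r lerDr divr_ge0 // ltW.
rewrite hornerD hornerM hornerX hornerC (le_trans (ler_normD _ _)) // mulrDl.
apply: lerD; last by rewrite ler_peMr.
rewrite normrM (ger0_norm x0) eE.
have -> : C * (2 / c) * (expR (c / 2 * x) * expR (c / 2 * x)) =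
   (C * expR (c / 2 * x)) * (2 / c * expR (c / 2 * x)) by ring.
by apply: ler_pM => //; apply: HC.
Qed.

Lemma weight_ge0 l zeta x : 0 <= weight l zeta x.
Proof. by rewrite mulr_ge0 ?powR_ge0 ?expR_ge0. Qed.

Lemma weight_gt0 l zeta x : 1 < x -> 0 < weight l zeta x.
Proof.
by move=> x1; rewrite mulr_gt0 ?powR_gt0 ?expR_gt0 // subr_gt0 exprn_egt1.
Qed.

Lemma weight_le_poly l zeta x : 1 <= x ->
  weight l zeta x <= x ^+ (2 * l.+1) * expR (- zeta * x).
Proof.
move=> x1; rewrite /weight ler_wpM2r ?expR_ge0 //.
have x21 : 1 <= x ^+ 2 by rewrite exprn_ege1.
rewrite exprM -(@powR_mulrn _ (x ^+ 2) l.+1) ?sqr_ge0 //.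
apply: (@le_trans _ _ ((x ^+ 2) `^ (l%:R + 1 / 2))).
  apply: ge0_ler_powR; rewrite ?nnegrE ?sqr_ge0 ?subr_ge0 //; last by lra.
by apply: ler_powR => //; rewrite -[l.+1%:R]natr1; lra.
Qed.

Lemma weightS l zeta x : 1 <= x ->
  weight l.+1 zeta x = (x ^+ 2 - 1) * weight l zeta x.
Proof.
move=> x1; rewrite /weight mulrA; congr (_ * _).
have x20 : 0 <= x ^+ 2 - 1 by rewrite subr_ge0 exprn_ege1.
rewrite -(@mulr_powRB1 _ _ (l.+1%:R + 1 / 2)) //.
  by congr (_ * _ `^ _); rewrite -[l.+1%:R]natr1; ring.
Qed.

Lemma measurable_poly_weight l zeta f :
  measurable_fun D (fun x => f.[x] * weight l zeta x).
Proof.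
apply: measurable_funM; first exact: measurable_poly.
apply: measurable_funM.
  apply: (@measurableT_comp _ _ _ _ _ _ (@powR R ^~ (l%:R + 1 / 2))).
    exact: measurable_powR.
  have -> : (fun x => x ^+ 2 - 1) = horner ('X^2 - 1 : {poly R}).
    by apply/funext => x; rewrite !hornerE.
  exact: measurable_poly.
apply: measurableT_comp; first exact: measurable_expR.
exact: measurable_funM.
Qed.

(** On [1, +oo[ the power in the weight is bounded by a polynomial, so half of
    the decay rate [zeta] absorbs every growing factor and the other half leaves
    an integrable exponential density. *)
Lemma integrable_poly_weight l zeta f : 0 < zeta ->
  mu.-integrable D (EFin \o (fun x => f.[x] * weight l zeta x)).
Proof.
move=> z0; have z20 : 0 < zeta / 2 by rewrite divr_gt0.
have [C HC] := poly_le_expR (f * 'X^(2 * l.+1)) z20.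
have C0 : 0 <= C.
  by have := le_trans (normr_ge0 _) (HC 0 (lexx 0)); rewrite mulr0 expR0 mulr1.
pose g x := (C * (2 / zeta)) * exponential_pdf (zeta / 2) x.
have gE x : 0 <= x -> g x = C * expR (- (zeta / 2) * x).
  move=> x0; rewrite /g exponential_pdfE // mulrA; congr (_ * _).
  by field; rewrite gt_eqF.
apply: (@le_integrable _ _ _ mu D _ _ (EFin \o g)) => //.
- by apply/measurable_EFinP; exact: measurable_poly_weight.
- move=> x; rewrite /= in_itv /= andbT => x1.
  have x0 : 0 <= x by rewrite (le_trans _ x1).
  rewrite lee_fin gE // (ger0_norm (mulr_ge0 C0 (expR_ge0 _))).
  rewrite normrM (ger0_norm (weight_ge0 _ _ _)).
  apply: (@le_trans _ _ (`|f.[x]| * (x ^+ (2 * l.+1) * expR (- zeta * x)))).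
    by rewrite ler_wpM2l // weight_le_poly.
  have := HC x x0; rewrite hornerM hornerXn normrM (ger0_norm (exprn_ge0 _ x0)).
  move=> /(ler_wpM2r (expR_ge0 (- zeta * x))); rewrite -!mulrA.
  move=> /le_trans; apply.
  rewrite -expRD ler_wpM2l // ler_expR le_eqVlt; apply/orP; left; apply/eqP.
  by field.
- apply: (@integrableS _ _ _ _ setT) => //.
  exact: (integrableZl measurableT (C * (2 / zeta))
    (integrable_exponential_pdf z20)).
Qed.

Section Moment.
Variables (l : nat) (zeta : R).
Hypothesis zeta_gt0 : 0 < zeta.

Lemma moment_is_linear : scalar (moment l zeta).
Proof.
move=> c f g; rewrite /moment.
rewrite (@eq_Rintegral _ _ R mu D (fun x => c * (f.[x] * weight l zeta x)
  + g.[x] * weight l zeta x)); last first.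
  by move=> x _; rewrite hornerD hornerZ mulrDl mulrA.
have If := integrable_poly_weight l f zeta_gt0.
rewrite RintegralD //; first by rewrite RintegralZl.
  exact: (integrableZl _ c If).
exact: integrable_poly_weight.
Qed.

Definition moment_scalar : {scalar {poly R}} :=
  HB.pack (moment l zeta) (GRing.isLinear.Build _ _ _ _ _ moment_is_linear).

(** If the integral were zero the integrand would vanish almost everywhere on
    [1, +oo[; but it vanishes there only at [1] and at the roots of [f]. *)
Lemma moment_gt0 f : f != 0 -> (forall x, 1 <= x -> 0 <= f.[x]) ->
  0 < moment l zeta f.
Proof.
move=> f0 fge0; set F := fun x => f.[x] * weight l zeta x.
have Fge0 x : D x -> 0 <= F x.
  by rewrite /= in_itv /= andbT => x1; rewrite mulr_ge0 ?fge0 ?weight_ge0.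
have mF := measurable_poly_weight l zeta f.
rewrite lt0r Rintegral_ge0 // andbT; apply/eqP => M0.
have int0 : (\int[mu]_(x in D) `|(EFin \o F) x| = 0)%E.
  rewrite (@eq_integral _ _ R mu D (EFin \o F)); last first.
    by move=> x; rewrite inE => /Fge0 Fx; rewrite /= ger0_norm.
  rewrite -[LHS]fineK; first by rewrite -[fine _]/(moment l zeta f) M0.
  exact: integrable_fin_num (integrable_poly_weight l f zeta_gt0).
have aeF : ae_eq mu D (EFin \o F) (cst 0%E).
  by apply/ae_eq_integral_abs; [exact: measurable_itv|exact/measurable_EFinP|].
have fin_neg : mu.-negligible [set` (1 :: rootsR f)].
  have c0 : countable [set` (1 :: rootsR f)].
    exact/finite_set_countable/finite_seq.
  apply/negligibleP; first exact: countable_measurable.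
  exact: countable_lebesgue_measure0.
have nD : mu.-negligible D.
  apply: (negligibleS _ (negligibleU aeF fin_neg)) => x Dx.
  have [xr|xr] := boolP (x \in 1 :: rootsR f); [by right|left => /=].
  move=> /(_ Dx) [] /eqP; rewrite mulf_eq0.
  move: xr; rewrite inE negb_or -roots_on_rootsR // in_itv /=.
  move=> /andP[x1 /negPf fx]; rewrite -[f.[x] == 0]/(root f x) fx /=.
  move: Dx; rewrite /= in_itv /= andbT le_eqVlt eq_sym (negPf x1) /= => x1'.
  by rewrite gt_eqF // weight_gt0.
have : mu D = 0%E by apply/negligibleP; first exact: measurable_itv.
by rewrite lebesgue_measure_itv /= ltry.
Qed.

Lemma omega_innerE f g :
  omega_inner l zeta f g =
    zeta / ((2 * l%:R + 1) * besselK 2 zeta) * moment l zeta (f * g).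
Proof.
rewrite /omega_inner /moment -RintegralZl //; last exact: integrable_poly_weight.
apply: eq_Rintegral => x _.
by rewrite hornerM /omega /weight; ring.
Qed.

(** The constant factor of [omega] may be cancelled without evaluating the
    Bessel function: were it zero, [P k] could not have norm one. *)
Lemma orthonormal_moment_orthogonal (P : nat -> {poly R}) k :
  orthonormal_polys l zeta P -> orthogonal_to_lower moment_scalar (P k).
Proof.
case=> sP _ ON; apply: orthogonal_family => // j jk.
have := ON k k; have := ON k j; rewrite eqxx (gtn_eqF jk) !omega_innerE.
set C := zeta / _ => /eqP; rewrite mulf_eq0 => /orP[/eqP->|/eqP //].
by rewrite mul0r => /esym/eqP; rewrite oner_eq0.
Qed.
End Moment.

Lemma momentS l zeta f :
  moment l.+1 zeta f = moment l zeta (('X^2 - 1) * f).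
Proof.
apply: eq_Rintegral => x; rewrite inE /= in_itv /= andbT => x1.
by rewrite weightS // hornerM hornerD hornerXn hornerN hornerC; ring.
Qed.
End Weight.

(** * The interlacing of the zeros *)

Theorem theorem3p6 (R : realType) (zeta : R) (P : nat -> nat -> {poly R})
    (l k : nat) (hl : (1 <= l)%N) (hk : (1 <= k)%N) (hzeta : 0 < zeta)
    (hP : forall m : nat, orthonormal_polys m zeta (P m)) :
  1 < poly_zero (P l.-1 k.+1) 1 /\
  (forall i : nat, (1 <= i <= k)%N ->
     poly_zero (P l.-1 k.+1) i < poly_zero (P l k) i /\
     poly_zero (P l k) i < poly_zero (P l.-1 k.+1) i.+1).
Proof.
case: l hl => [//|m] _ /=.
have L_pos : positive_functional 1 (moment_scalar m hzeta).
  by move=> f f0 f1; exact: moment_gt0.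
set p := P m k.+1; set q := P m.+1 k.
have Op : orthogonal_to_lower (moment_scalar m hzeta) p.
  exact: orthonormal_moment_orthogonal.
have sp : size p = k.+2 by have [sP _ _] := hP m; exact: sP.
have sq : size q = k.+1 by have [sP _ _] := hP m.+1; exact: sP.
have p_n0 : p != 0 by rewrite -size_poly_eq0 sp.
have q_n0 : q != 0 by rewrite -size_poly_eq0 sq.
split.
  apply: (orthogonal_roots_gt L_pos Op p_n0).
  by apply: (nth_rootsR_root L_pos Op p_n0); rewrite sp.
case=> [//|i] /andP[_ ik].
have sh : (size ('X^2 - 1 : {poly R})%R <= 3)%N.
  by rewrite -polyC1 size_XnsubC.
have h_gt0 x : 1 < x -> 0 < ('X^2 - 1 : {poly R}).[x].
  by move=> x1; rewrite !hornerE subr_gt0 exprn_egt1.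
have Oq (s : {poly R}) : (size s < size q)%N ->
    moment_scalar m hzeta (('X^2 - 1) * (q * s)) = 0.
  move=> ss; rewrite -[LHS]momentS.
  exact: (orthonormal_moment_orthogonal hzeta (hP m.+1)).
have spq : size p = (size q).+1 by rewrite sp sq.
have iq : (i.+1 < size q)%N by rewrite sq.
by apply/andP; exact: (rootsR_interlace L_pos Op p_n0 q_n0 spq sh h_gt0 Oq).
Qed.
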